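(* Let $L$ be a Lie hyperalgebra over a hyperfield $F$ and fix $n\ge1$. The following are equivalent: (i) $\mathcal{S}_n$ is transitive; (ii) $\mathcal{S}_n^*(x)=P(x)$ for every $x\in L$; (iii) $P(x)$ is an $\mathcal{S}_n$-part of $L$ for every $x\in L$.
   Context: **Hyperstructures.** $\mathscr{P}^*(H)$ is the set of non-empty subsets of $H$. A hyperoperation $\circ:H\times H\to\mathscr{P}^*(H)$ (and likewise any external map or hyperbracket with values in non-empty subsets) is extended to non-empty subsets by $A\circ B=\bigcup_{a\in A,b\in B}a\circ b$; elements are identified with singletons. $(H,\circ)$ is a semihypergroup if $\circ$ is associative, and a hypergroup if moreover $x\circ H=H\circ x=H$ for all $x\in H$. A hyperring $(R,+,\cdot)$: $(R,+)$ is a hypergroup, $(R,\cdot)$ a semihypergroup, and $\cdot$ is distributive over $+$. A hyperfield is a hyperring such that $(R,\cdot)$ (or $(R-\{0\},\cdot)$, if $R$ contains $0$) is a hypergroup. A hypervector space over a hyperfield $F$ is a hypergroup $(M,+)$ with a map $F\times M\to\mathscr{P}^*(M)$, $(a,x)\mapsto a\cdot x=ax$, such that $a(x+y)=ax+ay$, $(a+b)x=ax+bx$, $(ab)x=a(bx)$ for all $a,b\in F$, $x,y\in M$. Standing assumptions: every hypervector space $M$ has a scalar identity $0_M$ for $+$ (i.e. $0_M+x=x+0_M=\{x\}$), and every hyperfield $F$ has a scalar identity $0_F$ for $+$ and a multiplication unit $1$, such that $0_F x=\{0_M\}$ and $1x=\{x\}$ for all $x\in M$. **Lie hyperalgebras.**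 A Lie hyperalgebra over a hyperfield $F$ is a hypervector space $L$ over $F$ with a map (hyperbracket) $[-,-]:L\times L\to\mathscr{P}^*(L)$ that is bilinear, i.e. $[\lambda_1x_1+\lambda_2x_2,y]=\lambda_1[x_1,y]+\lambda_2[x_2,y]$ and $[x,\lambda_1y_1+\lambda_2y_2]=\lambda_1[x,y_1]+\lambda_2[x,y_2]$, such that $0\in[x,x]$ and $0\in[x,[y,z]]+[y,[z,x]]+[z,[x,y]]$ for all $x,y,z\in L$. Put $[A,B]=\bigcup_{a\in A,b\in B}[a,b]$, $L^{[0]}=L$, and $L^{[i]}=[L^{[i-1]},L^{[i-1]}]$ for $i\ge1$. **Hyperbracket functions.** A hyperbracket function $f(g_1,\dots,g_m)$ is an arbitrary composition of the arguments $g_1,\dots,g_m$ using only the hyperbracket (a bracket monomial, each argument used once; for $m=1$, $f(g)=g$), extended to subsets. **The relation $\mathcal{S}_n$.** $\mathbb{S}_t$ is the symmetric group on $\{1,\dots,t\}$. For $x,y\in L$, $x\,\mathcal{S}_n\,y$ if and only if there exist: $t\in\mathbb{N}$ and $\sigma\in\mathbb{S}_t$; for $1\le i\le t$, $m_i\in\mathbb{N}$, a hyperbracket function $f_i$ of $m_i$ arguments, elements $h_{i1},\dots,h_{im_i}\in L$, and $\sigma_i\in\mathbb{S}_{m_i}$ such that $\sigma_i(j)=j$ whenever $h_{ij}\notin L^{[n-1]}$; for $1\le j\le m_i$, $p_{ij}\in\mathbb{N}$ and $\sigma_{ij}\in\mathbb{S}_{p_{ij}}$; for $1\le k\le p_{ij}$,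 $q_{ijk}\in\mathbb{N}$, $\lambda_{ijk1},\dots,\lambda_{ijkq_{ijk}}\in F$ and $\sigma_{ijk}\in\mathbb{S}_{q_{ijk}}$; such that $$x\in\sum_{i=1}^t\ell_i,\quad \ell_i=f_i(g_{i1},\dots,g_{im_i}),\quad g_{ij}=\Big(\sum_{k=1}^{p_{ij}}\big(\prod_{r=1}^{q_{ijk}}\lambda_{ijkr}\big)\Big)\cdot h_{ij},$$ $$y\in\sum_{i=1}^t\ell'_i,\quad \ell'_i=f_{\sigma(i)}(g'_{i1},\dots,g'_{im_{\sigma(i)}}),\quad g'_{ij}=A_{\sigma(i)\sigma_{\sigma(i)}(j)}\cdot h_{\sigma(i)\sigma_{\sigma(i)}(j)}\ (1\le j\le m_{\sigma(i)}),$$ where $A_{ij}=\sum_{k=1}^{p_{ij}}B_{ij\sigma_{ij}(k)}$ and $B_{ijk}=\prod_{r=1}^{q_{ijk}}\lambda_{ijk\sigma_{ijk}(r)}$. (Sums and products are taken in the indicated order.) $\mathcal{S}_n$ is reflexive and symmetric; $\mathcal{S}_n^*$ is its transitive closure and $\mathcal{S}_n^*(x)$ is the equivalence class of $x$. **$\mathcal{S}_n$-parts.** A non-empty $K\subseteq L$ is an $\mathcal{S}_n$-part of $L$ if for every choice of $t\in\mathbb{N}$, $m_i\in\mathbb{N}$, hyperbracket functions $f_i$ of $m_i$ arguments, $h_{ij}\in L$, $p_{ij},q_{ijk}\in\mathbb{N}$ and $\lambda_{ijkr}\in F$ ($1\le i\le t$, $1\le j\le m_i$, $1\le k\le p_{ij}$,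 $1\le r\le q_{ijk}$), giving $\ell_i=f_i(g_{i1},\dots,g_{im_i})$ with $g_{ij}=\big(\sum_{k=1}^{p_{ij}}\prod_{r=1}^{q_{ijk}}\lambda_{ijkr}\big)\cdot h_{ij}$, and every choice of permutations $\sigma\in\mathbb{S}_t$, $\sigma_i\in\mathbb{S}_{m_i}$ with $\sigma_i(j)=j$ whenever $h_{ij}\notin L^{[n-1]}$, $\sigma_{ij}\in\mathbb{S}_{p_{ij}}$ and $\sigma_{ijk}\in\mathbb{S}_{q_{ijk}}$, giving $\ell'_i=f_{\sigma(i)}(g'_{i1},\dots,g'_{im_{\sigma(i)}})$ with $g'_{ij}=A_{\sigma(i)\sigma_{\sigma(i)}(j)}\cdot h_{\sigma(i)\sigma_{\sigma(i)}(j)}$, $A_{ij}=\sum_{k=1}^{p_{ij}}B_{ij\sigma_{ij}(k)}$ and $B_{ijk}=\prod_{r=1}^{q_{ijk}}\lambda_{ijk\sigma_{ijk}(r)}$, $\sum_{i=1}^t\ell_i\cap K\ne\emptyset$ implies $\sum_{i=1}^t\ell'_i\subseteq K$. **The set $P(x)$.** For $x\in L$ and $t\ge1$, $T_t(x)$ is the set of all $(\ell_1,\dots,\ell_t)$ with $x\in\sum_{i=1}^t\ell_i$, where $\ell_i=f_i(g_{i1},\dots,g_{im_i})$ with $m_i\in\mathbb{N}$, $f_i$ a hyperbracket function of $m_i$ arguments, and $g_{ij}=\big(\sum_{k=1}^{p_{ij}}\prod_{r=1}^{q_{ijk}}\lambda_{ijkr}\big)\cdot h_{ij}$ with $p_{ij},q_{ijk}\in\mathbb{N}$,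 $h_{ij}\in L$, $\lambda_{ijkr}\in F$; $P_t(x)$ is the union of all sets $\sum_{i=1}^t\ell'_i$ obtained from $(\ell_1,\dots,\ell_t)\in T_t(x)$ by all permutations $\sigma\in\mathbb{S}_t$, $\sigma_i\in\mathbb{S}_{m_i}$ with $\sigma_i(j)=j$ whenever $h_{ij}\notin L^{[n-1]}$, $\sigma_{ij}\in\mathbb{S}_{p_{ij}}$ and $\sigma_{ijk}\in\mathbb{S}_{q_{ijk}}$, where $\ell'_i=f_{\sigma(i)}(g'_{i1},\dots,g'_{im_{\sigma(i)}})$ with $g'_{ij}=A_{\sigma(i)\sigma_{\sigma(i)}(j)}\cdot h_{\sigma(i)\sigma_{\sigma(i)}(j)}$, $A_{ij}=\sum_{k=1}^{p_{ij}}B_{ij\sigma_{ij}(k)}$ and $B_{ijk}=\prod_{r=1}^{q_{ijk}}\lambda_{ijk\sigma_{ijk}(r)}$; and $P(x)=\bigcup_{t\ge1}P_t(x)$. *)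

(* Defs.v *)
From mathcomp Require Import all_boot all_fingroup.
From mathcomp Require Import classical_sets.
From Stdlib Require Import Relations.

Set Implicit Arguments.
Unset Strict Implicit.
Unset Printing Implicit Defensive.

Local Open Scope classical_set_scope.

Definition hext {A B C : Type} (op : A -> B -> set C) (X : set A) (Y : set B) :
    set C :=
  \bigcup_(x in X) \bigcup_(y in Y) op x y.

(* [op] restricts to a hyperoperation on the subset [H]; relativizing to a
   subset is needed for the multiplicative hypergroup of a hyperfield, which
   lives on the nonzero elements. *)
Definition semihypergroup_on {T : Type} (H : set T) (op : T -> T -> set T) :=
  (forall x y, H x -> H y -> op x y !=set0 /\ op x y `<=` H) /\
  (forall x y z, H x -> H y -> H z ->
     hext op (op x y) [set z] = hext op [set x] (op y z)).

Definition hypergroup_on {T : Type} (H : set T) (op : T -> T -> set T) :=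
  semihypergroup_on H op /\
  (forall x, H x -> hext op [set x] H = H /\ hext op H [set x] = H).

Definition scalar_identity {T : Type} (op : T -> T -> set T) (e : T) :=
  forall x, op e x = [set x] /\ op x e = [set x].

(* A unit in the sense of hyperstructures: [e x] and [x e] contain [x] but need
   not be reduced to it. *)
Definition hyper_unit {T : Type} (op : T -> T -> set T) (e : T) :=
  forall x, op e x x /\ op x e x.

Definition hyperring {T : Type} (add mul : T -> T -> set T) :=
  [/\ hypergroup_on setT add,
      semihypergroup_on setT mul,
      forall x y z, hext mul [set x] (add y z) = hext add (mul x y) (mul x z) &
      forall x y z, hext mul (add x y) [set z] = hext add (mul x z) (mul y z)].

Record hyperfield := Hyperfield {
  hf_sort :> Type;
  hf_add : hf_sort -> hf_sort -> set hf_sort;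
  hf_mul : hf_sort -> hf_sort -> set hf_sort;
  hf_zero : hf_sort;
  hf_one : hf_sort;
  hf_hyperring : hyperring hf_add hf_mul;
  hf_zeroP : scalar_identity hf_add hf_zero;
  hf_oneP : hyper_unit hf_mul hf_one;
  hf_mul_hypergroup : hypergroup_on [set a | a <> hf_zero] hf_mul
}.

Record hypervector_space (F : hyperfield) := HypervectorSpace {
  hv_sort :> Type;
  hv_add : hv_sort -> hv_sort -> set hv_sort;
  hv_scale : F -> hv_sort -> set hv_sort;
  hv_zero : hv_sort;
  hv_add_hypergroup : hypergroup_on setT hv_add;
  hv_scale_neq0 : forall a x, hv_scale a x !=set0;
  hv_scaleDr : forall a x y,
    hext hv_scale [set a] (hv_add x y) =
    hext hv_add (hv_scale a x) (hv_scale a y);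
  hv_scaleDl : forall a b x,
    hext hv_scale (hf_add a b) [set x] =
    hext hv_add (hv_scale a x) (hv_scale b x);
  hv_scaleA : forall a b x,
    hext hv_scale (hf_mul a b) [set x] =
    hext hv_scale [set a] (hv_scale b x);
  hv_zeroP : scalar_identity hv_add hv_zero;
  hv_scale0 : forall x, hv_scale (hf_zero F) x = [set hv_zero];
  hv_scale1 : forall x, hv_scale (hf_one F) x = [set x]
}.

Record lie_hyperalgebra (F : hyperfield) := LieHyperalgebra {
  lie_sort :> hypervector_space F;
  lie_br : lie_sort -> lie_sort -> set lie_sort;
  lie_br_neq0 : forall x y, lie_br x y !=set0;
  lie_br_linl : forall (a b : F) (x1 x2 y : lie_sort),
    hext lie_br (hext (@hv_add F lie_sort) (hv_scale a x1) (hv_scale b x2))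
      [set y] =
    hext (@hv_add F lie_sort)
      (hext (@hv_scale F lie_sort) [set a] (lie_br x1 y))
      (hext (@hv_scale F lie_sort) [set b] (lie_br x2 y));
  lie_br_linr : forall (a b : F) (x y1 y2 : lie_sort),
    hext lie_br [set x]
      (hext (@hv_add F lie_sort) (hv_scale a y1) (hv_scale b y2)) =
    hext (@hv_add F lie_sort)
      (hext (@hv_scale F lie_sort) [set a] (lie_br x y1))
      (hext (@hv_scale F lie_sort) [set b] (lie_br x y2));
  lie_br_alt : forall x, lie_br x x (hv_zero lie_sort);
  lie_br_jacobi : forall x y z,
    hext (@hv_add F lie_sort)
      (hext (@hv_add F lie_sort)
        (hext lie_br [set x] (lie_br y z))
        (hext lie_br [set y] (lie_br z x)))
      (hext lie_br [set z] (lie_br x y)) (hv_zero lie_sort)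
}.

(* A_0 op A_1 op ... op A_(n-1), bracketed to the left; set0 is a junk value for
   n = 0, which never occurs below. *)
Definition hbig {T : Type} (op : T -> T -> set T) (n : nat)
    (A : 'I_n -> set T) : set T :=
  if [seq A i | i <- enum 'I_n] is B :: s then foldl (hext op) B s else set0.

Inductive br_tree (I : Type) : Type :=
| BrLeaf of I
| BrNode of br_tree I & br_tree I.

Fixpoint br_leaves {I : Type} (b : br_tree I) : seq I :=
  match b with
  | BrLeaf i => [:: i]
  | BrNode l r => br_leaves l ++ br_leaves r
  end.

(* Bracket monomials using each of the m arguments exactly once, in any order;
   there is none for m = 0. *)
Record hyperbracket_function (m : nat) := HyperbracketFunction {
  hbf_tree :> br_tree 'I_m;
  hbf_leaves : perm_eq (br_leaves hbf_tree) (enum 'I_m)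
}.

Section Sn.
Variables (F : hyperfield) (L : lie_hyperalgebra F).

Fixpoint derived (i : nat) : set L :=
  if i is i'.+1 then hext (@lie_br F L) (derived i') (derived i') else setT.

(* As every argument is used exactly once, evaluating with the extended bracket
   is the same as extending the monomial from elements to subsets. *)
Fixpoint br_eval (I : Type) (b : br_tree I) (g : I -> set L) : set L :=
  match b with
  | BrLeaf i => g i
  | BrNode l r => hext (@lie_br F L) (br_eval l g) (br_eval r g)
  end.

(* Data f_i, h_ij, lambda_ijkr of a tuple (l_1, ..., l_t) with
   l_i = f_i(g_i1, ..., g_i(m_i)) and
   g_ij = (sum_(k < p_ij) prod_(r < q_ijk) lambda_ijkr) h_ij. *)
Record presentation (t : nat) := Presentation {
  pr_m : 'I_t -> nat;
  pr_f : forall i, hyperbracket_function (pr_m i);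
  pr_h : forall i, 'I_(pr_m i) -> L;
  pr_p : forall i, 'I_(pr_m i) -> nat;
  pr_p_gt0 : forall i j, 0 < @pr_p i j;
  pr_q : forall i j, 'I_(@pr_p i j) -> nat;
  pr_q_gt0 : forall i j k, 0 < @pr_q i j k;
  pr_lam : forall i j k, 'I_(@pr_q i j k) -> F
}.

(* ps, ps1, ps2, ps3 are sigma, sigma_i, sigma_ij, sigma_ijk. *)
Record pr_perms (n t : nat) (e : presentation t) := PrPerms {
  ps : {perm 'I_t};
  ps1 : forall i, {perm 'I_(pr_m e i)};
  ps2 : forall i (j : 'I_(pr_m e i)), {perm 'I_(pr_p j)};
  ps3 : forall i (j : 'I_(pr_m e i)) (k : 'I_(pr_p j)), {perm 'I_(pr_q k)};
  ps1_fix : forall i (j : 'I_(pr_m e i)),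
    ~ derived n.-1 (pr_h j) -> ps1 i j = j
}.

Section Values.
Variables (t : nat) (e : presentation t).

Definition pr_g (i : 'I_t) (j : 'I_(pr_m e i)) : set L :=
  hext (@hv_scale F L)
    (hbig (@hf_add F) (fun k : 'I_(pr_p j) =>
       hbig (@hf_mul F) (fun r : 'I_(pr_q k) => [set pr_lam r])))
    [set pr_h j].

Definition pr_l (i : 'I_t) : set L := br_eval (pr_f e i) (@pr_g i).

Definition pr_val : set L := hbig (@hv_add F L) pr_l.

Variables (n : nat) (s : pr_perms n e).

Definition pr_B (i : 'I_t) (j : 'I_(pr_m e i)) (k : 'I_(pr_p j)) : set F :=
  hbig (@hf_mul F) (fun r : 'I_(pr_q k) => [set pr_lam (ps3 s k r)]).

Definition pr_A (i : 'I_t) (j : 'I_(pr_m e i)) : set F :=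
  hbig (@hf_add F) (fun k : 'I_(pr_p j) => pr_B (ps2 s j k)).

Definition pr_l' (i : 'I_t) : set L :=
  br_eval (pr_f e (ps s i)) (fun j : 'I_(pr_m e (ps s i)) =>
    hext (@hv_scale F L) (pr_A (ps1 s (ps s i) j))
      [set pr_h (ps1 s (ps s i) j)]).

Definition pr_val' : set L := hbig (@hv_add F L) pr_l'.

End Values.

Definition S_rel (n : nat) (x y : L) : Prop :=
  exists (t : nat) (e : presentation t) (s : pr_perms n e),
    [/\ 0 < t, pr_val e x & pr_val' s y].

Definition S_class (n : nat) (x : L) : set L :=
  [set y | clos_trans L (S_rel n) x y].

Definition S_part (n : nat) (K : set L) : Prop :=
  K !=set0 /\
  forall (t : nat) (e : presentation t) (s : pr_perms n e),
    0 < t -> pr_val e `&` K !=set0 -> pr_val' s `<=` K.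

(* The tuples (l_1, ..., l_t) are kept together with the presentation that the
   permutations act on. *)
Definition T_set (t : nat) (x : L) : set (presentation t) :=
  [set e | pr_val e x].
Arguments T_set t x : clear implicits.

Definition P_set_at (n t : nat) (x : L) : set L :=
  \bigcup_(e in T_set t x) \bigcup_(s in [set: pr_perms n e]) pr_val' s.

Definition P_set (n : nat) (x : L) : set L :=
  \bigcup_(t in [set t | 0 < t]) P_set_at n t x.

End Sn.

Arguments S_rel {F} L n x y.
Arguments S_class {F} L n x.
Arguments S_part {F} L n K.
Arguments P_set {F} L n x.

(* Main.v *)
Require Import Defs.
From mathcomp Require Import all_boot all_fingroup.
From mathcomp Require Import classical_sets.
From Stdlib Require Import Relations.

(** [P_set L n x] is the one-step neighbourhood of [x] under [S_rel]
    ([P_setE]), and an [S_part] is a non-empty set that one step of [S_rel]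
    cannot leave ([S_partP]).  The three conditions are therefore three ways of
    saying that a second step reaches nothing that a first step does not: two
    steps collapse to one (i), so does any chain of steps (ii), and the
    neighbourhoods are closed under steps (iii).

    An [S_part] must moreover be non-empty, so from (ii) to (iii) every element
    needs a step starting from it.  One is provided by reflexivity
    ([S_rel_refl]), because the presentation of [x] as [1 x] has the singleton
    of [x] as its value, both before and after permuting. *)

Set Implicit Arguments.
Unset Strict Implicit.

Local Open Scope classical_set_scope.

Lemma hext11 {A B C : Type} (op : A -> B -> set C) (a : A) (b : B) :
  hext op [set a] [set b] = op a b.
Proof. by rewrite /hext !bigcup_set1. Qed.

Lemma hbig1 {T : Type} (op : T -> T -> set T) (A : 'I_1 -> set T) :
  hbig op A = A ord0.
Proof. by rewrite /hbig enum_ordSl enum_ord0. Qed.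

Section Neighbourhoods.
Variables (F : hyperfield) (L : lie_hyperalgebra F) (n : nat).

Lemma P_setE (x : L) : P_set L n x = [set y | S_rel L n x y].
Proof.
apply/seteqP; split=> y.
- by case=> t t_gt0 [e ex [s _ sy]]; exists t, e, s.
- by case=> t [e [s [t_gt0 ex sy]]]; exists t => //; exists e => //; exists s.
Qed.

(** The sets that [S_part] compares are the values of one presentation before
    and after permuting, and [S_rel] relates the elements of the former to those
    of the latter. *)
Lemma S_partP (K : set L) :
  S_part L n K <->
  K !=set0 /\ forall x y, K x -> S_rel L n x y -> K y.
Proof.
split=> -[K_neq0 Kclosed]; split=> //.
- move=> x y Kx [t [e [s [t_gt0 ex sy]]]].
  by apply: (Kclosed t e s t_gt0) sy; exists x.
- move=> t e s t_gt0 [x [ex Kx]] y sy.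
  by apply: (Kclosed x) => //; exists t, e, s.
Qed.

Lemma leaf_ord1_perm : perm_eq (br_leaves (BrLeaf (@ord0 0))) (enum 'I_1).
Proof. by rewrite enum_ordSl enum_ord0. Qed.

(** The trivial way of writing [x] as [1 x], with all sums, products and
    brackets of length one. *)
Definition unit_presentation (x : L) : presentation L 1 :=
  @Presentation F L 1 (fun=> 1%N)
    (fun=> HyperbracketFunction leaf_ord1_perm) (fun _ _ => x)
    (fun _ _ => 1%N) (fun _ _ => isT) (fun _ _ _ => 1%N) (fun _ _ _ => isT)
    (fun _ _ _ _ => hf_one F).

Definition unit_perms (x : L) : pr_perms n (unit_presentation x) :=
  @PrPerms F L n 1 (unit_presentation x) 1%g (fun=> 1%g) (fun _ _ => 1%g)
    (fun _ _ _ => 1%g) (fun i j _ => perm1 j).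

(** With sums, products and brackets of length one there is nothing to permute,
    and the axiom [1 x = {x}] collapses both values to the singleton of [x]. *)
Lemma S_rel_refl (x : L) : S_rel L n x x.
Proof.
exists 1%N, (unit_presentation x), (unit_perms x); split=> //.
- by rewrite /pr_val hbig1 /pr_l /= /pr_g /= !hbig1 hext11 hv_scale1.
- rewrite /pr_val' hbig1 /pr_l' /= /pr_A /= hbig1 /pr_B /= hbig1.
  by rewrite hext11 hv_scale1.
Qed.

End Neighbourhoods.

Theorem theorem3p12 (F : hyperfield) (L : lie_hyperalgebra F) (n : nat)
    (n_ge1 : (1 <= n)%N) :
  [<-> transitive L (S_rel L n);
       forall x : L, S_class L n x = P_set L n x;
       forall x : L, S_part L n (P_set L n x)].
Proof.
tfae.
- move=> S_trans x; rewrite P_setE; apply/seteqP; split=> y; last exact: t_step.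
  by elim=> // u v w _ Suv _; apply: S_trans Suv.
- move=> classE x; apply/S_partP; split.
    by exists x; rewrite P_setE; exact: S_rel_refl.
  rewrite -classE => y z xy Syz; apply: t_trans xy _; exact: t_step.
- move=> partP x y z Sxy Syz.
  (* The first step puts [y] in [P_set L n x], which the second cannot leave. *)
  have /S_partP[_ closedP] := partP x.
  by move: closedP; rewrite P_setE; apply; [exact: Sxy | exact: Syz].
Qed.
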